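(* Let $C$ be an extended linear code of length $d+1$ over $\mathbb{Z}_N$ and let $g=(g_{ji})$ be a generating matrix of $C$, with $m$ rows and with columns indexed by $i=0,\dots,d$. Put $\gcd_i=\gcd(g_{1i},\dots,g_{mi},N)$. If the linear code $C$ is thin, then $$\sum_{i=0}^d \gcd\nolimits_i>N.$$
   Context: $\mathbb{Z}_N=\mathbb{Z}/N\mathbb{Z}$; its elements are identified with the representatives $0,1,\dots,N-1$, and gcd's are taken of these integers. A linear code of length $n$ over $\mathbb{Z}_N$ is a submodule $C\subseteq\mathbb{Z}_N^n$; its elements are called words; a generating matrix is a matrix whose rows generate $C$. $C$ is extended if every word has coordinate sum $0\bmod N$. An extended code is thin if it contains no word of maximal weight, i.e. no word all of whose entries are nonzero.
   Formalization: The formal theorem assumes d ≥ 1: for d = 0 the only extended code is C = {0}, which is thin and has gcd_0 = N, so the sum equals N and the strict inequality fails. *)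

(* Defs.v *)
From HB Require Import structures.
From mathcomp Require Import all_boot all_order all_algebra.

Set Implicit Arguments.
Unset Strict Implicit.
Unset Printing Implicit Defensive.

Import GRing.Theory.
Local Open Scope ring_scope.

(* Z/NZ for every N >= 1 (and the junk value Z/1Z for N = 0).  The library's
   'Z_N denotes Z/2Z when N = 1, and 'I_1 carries no ring structure there. *)
Definition Zmod (N : nat) : Type := 'I_N.-1.+1.

HB.instance Definition _ (N : nat) := Finite.copy (Zmod N) 'I_N.-1.+1.
HB.instance Definition _ (N : nat) := GRing.Zmodule.copy (Zmod N) 'I_N.-1.+1.
HB.instance Definition _ (N : nat) :=
  GRing.Zmodule_isComPzRing.Build (Zmod N)
    (@Zp_mulA N.-1.+1) (@Zp_mulC N.-1.+1) (@Zp_mul1z N.-1) (@Zp_mul_addl N.-1.+1).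

Definition residue (N : nat) (x : Zmod N) : nat := nat_of_ord x.

Section Codes.
Variables N n : nat.
Implicit Types (v : 'rV[Zmod N]_n) (C : {set 'rV[Zmod N]_n}).

Definition linear_code C : Prop := submod_closed C.

Definition generating_matrix (m : nat) (g : 'M[Zmod N]_(m, n)) C : Prop :=
  C = [set c *m g | c : 'rV[Zmod N]_m].

Definition extended C : Prop :=
  forall v, v \in C -> \sum_(i < n) v 0 i = 0.

Definition maximal_weight v : Prop := forall i : 'I_n, v 0 i != 0.

Definition thin C : Prop :=
  extended C /\ ~ (exists2 v, v \in C & maximal_weight v).

Definition col_gcd (m : nat) (g : 'M[Zmod N]_(m, n)) (i : 'I_n) : nat :=
  \big[gcdn/N]_(j < m) residue (g j i).

End Codes.

(* Main.v *)
(* Each coordinate i defines an additive map c |-> (c *m g)_i from coefficient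
   vectors to Z_N; by Bezout it takes the value gcd_i, so its image has at least
   N / gcd_i elements and its kernel K_i satisfies N |K_i| <= gcd_i |Z_N^m|.
   Thinness says that the K_i cover Z_N^m.  As they all contain 0 and there are
   at least two of them, |Z_N^m| < sum_i |K_i|. *)

Require Import Defs.
From mathcomp Require Import all_boot all_order all_algebra.

Import GRing.Theory.
Local Open Scope ring_scope.

Lemma residue_natr (N n : nat) :
  (0 < N)%N -> residue (n%:R : Zmod N) = (n %% N)%N.
Proof.
case: N => // N _; elim: n => [|n IHn]; first by rewrite mod0n.
have -> : residue (n.+1%:R : Zmod N.+1)
        = ((1 %% N.+1 + residue (n%:R : Zmod N.+1)) %% N.+1)%N.
  by rewrite mulrS.
by rewrite IHn modnDm add1n.
Qed.

Lemma natr_residue (N : nat) (x : Zmod N) :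
  (0 < N)%N -> (residue x)%:R = x.
Proof.
move=> N_gt0; apply: val_inj; apply: (etrans (residue_natr N _ N_gt0)).
by case: N N_gt0 x => // N _ x; rewrite modn_small // ltn_ord.
Qed.

Section ColumnGcd.
Variables N m n : nat.
Hypothesis N_gt0 : (0 < N)%N.
Implicit Types (g : 'M[Zmod N]_(m, n)) (i : 'I_n) (c : 'rV[Zmod N]_m).

Lemma col_gcd_dvdn g i : (col_gcd g i %| N)%N.
Proof.
rewrite /col_gcd; elim/big_rec: _ => // j x _ xN.
exact: dvdn_trans (dvdn_gcdr _ _) xN.
Qed.

Lemma mulmx_coordMn g i c k : (c *+ k *m g) 0 i = (c *m g) 0 i *+ k.
Proof.
elim: k => [|k IHk]; first by rewrite !mulr0n mul0mx mxE.
by rewrite !mulrS mulmxDl mxE IHk.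
Qed.

Lemma col_gcd_attained g i : exists c, (c *m g) 0 i = (col_gcd g i)%:R.
Proof.
rewrite /col_gcd; elim/big_ind: _ => [|a b|j _].
- exists 0; rewrite mul0mx mxE; apply: val_inj.
  by rewrite [RHS](residue_natr N N N_gt0) modnn.
- case: (posnP a) => [-> _ [c cb]|a_gt0 [ca cag] [cb cbg]].
    by exists c; rewrite gcd0n.
  case: (egcdnP b a_gt0) => ka kb kab _.
  exists (ca *+ ka - cb *+ kb).
  rewrite mulmxBl mxE [X in _ + X]mxE !mulmx_coordMn cag cbg -!mulrnA.
  by rewrite (mulnC a) (mulnC b) kab mulrnDr addrAC subrr add0r.
- by exists (delta_mx 0 j); rewrite -rowE mxE natr_residue.
Qed.

Lemma card_coord_kernel g i :
  (N * #|[set c : 'rV[Zmod N]_m | ((c *m g) 0 i == 0)%R]|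
     <= col_gcd g i * #|{: 'rV[Zmod N]_m}|)%N.
Proof.
set K := [set c | _]; set D := col_gcd g i.
have [c0 c0g] : exists c, (c *m g) 0 i = D%:R by exact: col_gcd_attained.
have /dvdnP[q defN] : (D %| N)%N by exact: col_gcd_dvdn.
have D_gt0 : (0 < D)%N by move: N_gt0; rewrite {1}defN muln_gt0 => /andP[].
rewrite {1}defN (mulnC q) -mulnA leq_pmul2l // mulnC -(card_ord q).
rewrite -cardsT -cardsX.
(* The translates of K by the multiples t * c0, t < q, are pairwise disjoint:
   the i-th coordinate t * D < N recovers t. *)
pose f (p : 'rV[Zmod N]_m * 'I_q) := p.1 + c0 *+ p.2.
have f_inj : {in setX K [set: 'I_q] &, injective f}.
  have fi c t : c \in K -> residue ((f (c, t) *m g) 0 i) = (D * t)%N.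
    rewrite inE => /eqP cK.
    rewrite mulmxDl mxE cK add0r mulmx_coordMn c0g -mulrnA residue_natr //.
    by rewrite modn_small // [X in (_ < X)%N]defN mulnC ltn_pmul2r // ltn_ord.
  move=> [c s] [c' t]; rewrite !in_setX /= => /andP[cK _] /andP[c'K _] eq_f.
  have eq_st : s = t.
    have /eqP : (D * s)%N = (D * t)%N by rewrite -(fi c) // eq_f fi.
    by rewrite eqn_pmul2l // => /eqP/val_inj.
  by move: eq_f; rewrite /f eq_st /= => /addIr ->.
by rewrite -(card_in_imset f_inj) max_card.
Qed.

End ColumnGcd.

Lemma card_cover_lt (T : finType) (n : nat) (K : 'I_n -> {set T}) (x0 : T) :
  (1 < n)%N -> (forall i, x0 \in K i) -> (forall x, exists i, x \in K i) ->
  (#|T| < \sum_i #|K i|)%N.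
Proof.
move=> n_gt1 x0K cover.
have -> : (\sum_i #|K i| = \sum_(x : T) #|[set i | x \in K i]|)%N.
  under eq_bigr do rewrite -sum1_card.
  under [RHS]eq_bigr do rewrite -sum1_card.
  rewrite (exchange_big_dep xpredT) //=.
  by apply: eq_bigr => x _; apply: eq_bigl => i; rewrite inE.
rewrite -sum1_card (bigD1 x0) //= [X in (_ < X)%N](bigD1 x0) //= -addSn.
apply: leq_add.
  suff -> : [set i | x0 \in K i] = setT by rewrite cardsT card_ord.
  by apply/setP => i; rewrite !inE x0K.
apply: leq_sum => x _; have [i xKi] := cover x.
by apply/card_gt0P; exists i; rewrite inE.
Qed.

Theorem proposition2p12 (N d m : nat) (hN : (0 < N)%N) (hd : (0 < d)%N)
    (C : {set 'rV[Zmod N]_d.+1}) (g : 'M[Zmod N]_(m, d.+1)) :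
  linear_code C -> extended C -> generating_matrix g C -> thin C ->
  (N < \sum_(i < d.+1) col_gcd g i)%N.
Proof.
move=> _ _ defC [_ thinC].
pose K i := [set c : 'rV[Zmod N]_m | (c *m g) 0 i == 0].
have cover (c : 'rV[Zmod N]_m) : exists i, c \in K i.
  apply/existsP; apply: contraT; rewrite negb_exists => /forallP cK.
  case: thinC; exists (c *m g); first by rewrite defC; apply/imsetP; exists c.
  by move=> i; have := cK i; rewrite inE.
have K0 i : 0 \in K i by rewrite inE mul0mx mxE.
have ltK := card_cover_lt _ _ K 0 hd K0 cover.
have V_gt0 : (0 < #|{: 'rV[Zmod N]_m}|)%N by apply/card_gt0P; exists 0.
rewrite -(ltn_pmul2r V_gt0) big_distrl /=.
apply: (@leq_trans (N * \sum_i #|K i|)); first by rewrite ltn_pmul2l.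
by rewrite big_distrr /=; apply: leq_sum => i _; apply: card_coord_kernel.
Qed.
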